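(* Quantum alternation $\bullet$ is not monotone with respect to the order $\sqsubseteq$ on Kraus decompositions. That is, there exist finite-dimensional complex Hilbert spaces $\mathcal{H}, \mathcal{K}$ and Kraus decompositions $\mathcal{S}, \mathcal{S}', \mathcal{T}, \mathcal{T}' : \mathcal{H} \to \mathcal{K}$ such that $\mathcal{S} \sqsubseteq \mathcal{S}'$ and $\mathcal{T} \sqsubseteq \mathcal{T}'$, but $\mathcal{S} \bullet \mathcal{T} \not\sqsubseteq \mathcal{S}' \bullet \mathcal{T}'$.
   Context: All Hilbert spaces are complex and finite-dimensional, and $B(\mathcal{H},\mathcal{K})$ denotes the linear operators from $\mathcal{H}$ to $\mathcal{K}$. A Kraus decomposition $\mathcal{S} : \mathcal{H} \to \mathcal{K}$ is a finite set $\mathcal{S} \subset B(\mathcal{H},\mathcal{K})$ of nonzero operators with $\sum_{E \in \mathcal{S}} E^\dagger E \le I$ (Loewner order on operators). It determines a superoperator (completely positive trace-nonincreasing map) $T_{\mathcal{S}}(\rho) = \sum_{E \in \mathcal{S}} E \rho E^\dagger$ from operators on $\mathcal{H}$ to operators on $\mathcal{K}$. The empty set $\emptyset$ is a Kraus decomposition, corresponding to the zero superoperator. Order: for $\mathcal{S}, \mathcal{T} : \mathcal{H} \to \mathcal{K}$, write $\mathcal{S} \sqsubseteq \mathcal{T}$ if $T_{\mathcal{S}} \sqsubseteq T_{\mathcal{T}}$ in the standard order on completely positive maps, i.e. if $T_{\mathcal{T}} - T_{\mathcal{S}}$ is completely positive. Quantum alternation: let $\mathbf{qbit} = \mathbb{C}^2$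 with computational basis $|0\rangle, |1\rangle$, and let $\Pi_0 = |0\rangle\langle 0|$, $\Pi_1 = |1\rangle\langle 1|$. For nonempty Kraus decompositions $\mathcal{S}, \mathcal{T} : \mathcal{H} \to \mathcal{K}$, the quantum alternation $\mathcal{S} \bullet \mathcal{T} : \mathbf{qbit} \otimes \mathcal{H} \to \mathbf{qbit} \otimes \mathcal{K}$ is the Kraus decomposition $$\mathcal{S} \bullet \mathcal{T} = \left\{ \Pi_0 \otimes \frac{E}{\sqrt{|\mathcal{T}|}} + \Pi_1 \otimes \frac{F}{\sqrt{|\mathcal{S}|}} \;\middle|\; E \in \mathcal{S},\ F \in \mathcal{T} \right\},$$ where $|\cdot|$ denotes cardinality. If one of the two is empty, the convention is $\mathcal{S} \bullet \emptyset = \{\Pi_0 \otimes E \mid E \in \mathcal{S}\}$ and $\emptyset \bullet \mathcal{T} = \{\Pi_1 \otimes F \mid F \in \mathcal{T}\}$ (so $\emptyset \bullet \emptyset = \emptyset$). *)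

(* Defs.v *)
From HB Require Import structures.
From mathcomp Require Import all_boot all_order all_algebra.
From mathcomp Require Import finmap mxtens complex.
From mathcomp Require Import reals.
Set Implicit Arguments. Unset Strict Implicit. Unset Printing Implicit Defensive.
Import Order.TTheory GRing.Theory Num.Theory.
Local Open Scope fset_scope.
Local Open Scope ring_scope.
Local Open Scope sesquilinear_scope.

(* The Hilbert space of dimension n is C^n, so B(H, K) is 'M[C]_(k, h) acting
   on column vectors, M ^t* is the adjoint, and C^m (x) C^n is C^(m * n) with
   the Kronecker product *t as tensor product of operators.  Everything is
   defined over a numClosedFieldType C, to be instantiated with R[i]. *)

(* In C, 0 <= z entails that z is real. *)
Definition psdmx (C : numClosedFieldType) (n : nat) (A : 'M[C]_n) : Prop :=
  forall x : 'cV[C]_n, 0 <= (x ^t* *m A *m x) 0 0.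

Definition loewner_le (C : numClosedFieldType) (n : nat) (A B : 'M[C]_n) : Prop :=
  psdmx (B - A).

Definition tens_block (C : numClosedFieldType) (d h : nat) (i j : 'I_d)
    (X : 'M[C]_(d * h)) : 'M[C]_h :=
  \matrix_(a, b) X (mxtens_index (i, a)) (mxtens_index (j, b)).

(* id_d (x) f, see ampliation_tens. *)
Definition ampliation (C : numClosedFieldType) (d h k : nat)
    (f : 'M[C]_h -> 'M[C]_k) (X : 'M[C]_(d * h)) : 'M[C]_(d * k) :=
  \sum_(i < d) \sum_(j < d) delta_mx i j *t f (tens_block i j X).

Lemma ampliation_tens (C : numClosedFieldType) (d h k : nat)
    (f : {linear 'M[C]_h -> 'M[C]_k}) (A : 'M[C]_d) (B : 'M[C]_h) :
  ampliation f (A *t B) = A *t f B.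
Proof.
have blk i j : tens_block i j (A *t B) = A i j *: B.
  by apply/matrixP => a b; rewrite [LHS]mxE tensmxE [RHS]mxE.
apply/matrixP => r s; case: (mxtens_indexP r) => i a; case: (mxtens_indexP s) => j b.
rewrite /ampliation tensmxE summxE (bigD1 i) //= summxE (bigD1 j) //= !big1 ?addr0.
- by rewrite tensmxE blk mxE !eqxx mul1r linearZ /= mxE.
- move=> i' hi; rewrite summxE big1 // => j' _.
  by rewrite tensmxE mxE [i == i']eq_sym (negPf hi) mul0r.
- by move=> j' hj; rewrite tensmxE mxE [j == j']eq_sym (negPf hj) andbF mul0r.
Qed.

Definition completely_positive (C : numClosedFieldType) (h k : nat)
    (f : {linear 'M[C]_h -> 'M[C]_k}) : Prop :=
  forall (d : nat) (X : 'M[C]_(d * h)), psdmx X -> psdmx (ampliation f X).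

Definition cp_le (C : numClosedFieldType) (h k : nat)
    (f g : {linear 'M[C]_h -> 'M[C]_k}) : Prop :=
  completely_positive (g \- f).

Record kraus (C : numClosedFieldType) (h k : nat) := Kraus {
  kraus_ops :> {fset 'M[C]_(k, h)};
  kraus_neq0 : 0 \notin kraus_ops;
  kraus_le1 : loewner_le (\sum_(E <- kraus_ops) E ^t* *m E) 1%:M }.

Definition superop (C : numClosedFieldType) (h k : nat) (S : {fset 'M[C]_(k, h)})
    (rho : 'M[C]_h) : 'M[C]_k := \sum_(E <- S) E *m rho *m E ^t*.

Lemma superop_is_linear (C : numClosedFieldType) (h k : nat)
    (S : {fset 'M[C]_(k, h)}) : linear (superop S).
Proof.
move=> a u v; rewrite /superop scaler_sumr -big_split /=.
by apply: eq_bigr => E _; rewrite mulmxDr mulmxDl -scalemxAr -scalemxAl.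
Qed.

HB.instance Definition _ (C : numClosedFieldType) (h k : nat)
    (S : {fset 'M[C]_(k, h)}) :=
  GRing.isLinear.Build C 'M[C]_h 'M[C]_k _ (superop S) (superop_is_linear S).

Definition kraus_le (C : numClosedFieldType) (h k : nat) (S T : kraus C h k) : Prop :=
  cp_le (superop S) (superop T).

(* |b><b| on qbit = C^2. *)
Definition qproj (C : numClosedFieldType) (b : 'I_2) : 'M[C]_2 := delta_mx b b.

Definition qalt_op (C : numClosedFieldType) (h k : nat)
    (E F : 'M[C]_(k, h)) : 'M[C]_(2 * k, 2 * h) :=
  qproj C 0 *t E + qproj C 1 *t F.

Definition qalt_ops (C : numClosedFieldType) (h k : nat)
    (S T : {fset 'M[C]_(k, h)}) : {fset 'M[C]_(2 * k, 2 * h)} :=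
  if T == fset0 then [fset qproj C 0 *t E | E in S]
  else if S == fset0 then [fset qproj C 1 *t F | F in T]
  else [fset qalt_op ((sqrtC #|` T|%:R)^-1 *: E) ((sqrtC #|` S|%:R)^-1 *: F)
       | E in S, F in T].

Section QaltKraus.
Variables (C : numClosedFieldType) (h k : nat).
Implicit Types (S T : kraus C h k) (E F : 'M[C]_(k, h)).

Lemma tensmxDr (m n p q : nat) (M : 'M[C]_(m, n)) (A B : 'M[C]_(p, q)) :
  M *t (A + B) = M *t A + M *t B.
Proof.
apply/matrixP => r s; case: (mxtens_indexP r) => i a; case: (mxtens_indexP s) => j b.
by rewrite [RHS]mxE !tensmxE mxE mulrDr.
Qed.

Lemma tensmx_sumr (I : Type) (r : seq I) (m n p q : nat) (M : 'M[C]_(m, n))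
    (A : I -> 'M[C]_(p, q)) :
  M *t (\sum_(i <- r) A i) = \sum_(i <- r) M *t A i.
Proof.
by elim/big_rec2: _ => [|i y1 y2 _ <-]; [exact: tensmx0 | exact: tensmxDr].
Qed.

Lemma adjmx_tens (m n p q : nat) (A : 'M[C]_(m, n)) (B : 'M[C]_(p, q)) :
  (A *t B) ^t* = A ^t* *t B ^t*.
Proof. by rewrite trmx_tens map_mxT. Qed.

Lemma adjmxD (m n : nat) (A B : 'M[C]_(m, n)) : (A + B) ^t* = A ^t* + B ^t*.
Proof. by apply/matrixP => i j; rewrite !mxE rmorphD. Qed.

Lemma adj_qproj (b : 'I_2) : (qproj C b) ^t* = qproj C b.
Proof.
by apply/matrixP => i j; rewrite !mxE andbC conjC_nat.
Qed.

Lemma qproj_mul (a b : 'I_2) : qproj C a *m qproj C b = (a == b)%:R *: qproj C a.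
Proof.
rewrite /qproj mul_delta_mx_cond; case: eqP => [->|_]; first by rewrite scale1r mulr1n.
by rewrite scale0r mulr0n.
Qed.

Lemma qalt_op_gram E F :
  (qalt_op E F) ^t* *m qalt_op E F
  = qproj C 0 *t (E ^t* *m E) + qproj C 1 *t (F ^t* *m F).
Proof.
rewrite /qalt_op adjmxD !adjmx_tens !adj_qproj mulmxDl !mulmxDr.
by rewrite !tensmx_mul !qproj_mul /= !scale0r !tens0mx !scale1r addr0 add0r.
Qed.

Lemma qalt_op_inj E F E' F' : qalt_op E F = qalt_op E' F' -> E = E' /\ F = F'.
Proof.
move=> /matrixP eqG; split; apply/matrixP => a b.
  have := eqG (mxtens_index (0, a)) (mxtens_index (0, b)).
  by rewrite !mxE !mxtens_indexK /= !mul1r !mul0r !addr0.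
have := eqG (mxtens_index (1, a)) (mxtens_index (1, b)).
by rewrite !mxE !mxtens_indexK /= !mul1r !mul0r !add0r.
Qed.

Lemma qalt_op_eq0 E F : qalt_op E F = 0 -> E = 0 /\ F = 0.
Proof.
move=> e; apply: qalt_op_inj; rewrite e.
by rewrite /qalt_op !tensmx0 addr0.
Qed.

Lemma psdmx_qproj (b : 'I_2) (A : 'M[C]_h) : psdmx A -> psdmx (qproj C b *t A).
Proof.
move=> psdA x; pose y : 'cV[C]_h := \col_a x (mxtens_index (b, a)) 0.
suff -> : (x ^t* *m (qproj C b *t A) *m x) 0 0 = (y ^t* *m A *m y) 0 0 by exact: psdA.
pose W : 'M[C]_(2 * h, h) := \matrix_(r, a) (r == mxtens_index (b, a))%:R.
have Wy : W ^t* *m x = y.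
  apply/matrixP => a c; rewrite !mxE (bigD1 (mxtens_index (b, a))) //= big1 => [|r hr].
    by rewrite !mxE eqxx conjC1 mul1r addr0 [c]ord1.
  by rewrite !mxE (negPf hr) conjC0 mul0r.
have WA : qproj C b *t A = W *m A *m W ^t*.
  apply/matrixP => r s; case: (mxtens_indexP r) => i a; case: (mxtens_indexP s) => j c.
  have eqix (p q : 'I_2 * 'I_h) : (mxtens_index p == mxtens_index q) = (p == q).
    exact: (can_eq (@mxtens_indexK 2 h)).
  rewrite tensmxE !mxE (bigD1 c) //= big1 => [|c' hc]; last first.
    by rewrite !mxE eqix xpair_eqE [c == c']eq_sym (negPf hc) andbF conjC0 mulr0.
  rewrite addr0 !mxE (bigD1 a) //= big1 => [|a' ha]; last first.
    by rewrite !mxE eqix xpair_eqE [a == a']eq_sym (negPf ha) andbF mul0r.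
  rewrite !mxE !eqix !xpair_eqE !eqxx !andbT addr0 conjC_nat.
  by case: (i == b); case: (j == b); rewrite /= ?mul1r ?mulr1 ?mul0r ?mulr0.
by rewrite WA -Wy trmx_mul map_mxM trmxCK !mulmxA.
Qed.

Lemma qalt_le1 (A B : 'M[C]_h) : loewner_le A 1%:M -> loewner_le B 1%:M ->
  loewner_le (qproj C 0 *t A + qproj C 1 *t B) 1%:M.
Proof.
move=> leA leB x.
have -> : 1%:M - (qproj C 0 *t A + qproj C 1 *t B)
          = qproj C 0 *t (1%:M - A) + qproj C 1 *t (1%:M - B).
  apply/matrixP => r s; case: (mxtens_indexP r) => i a; case: (mxtens_indexP s) => j b.
  rewrite [LHS]mxE [in LHS]mxE [in X in _ + X]mxE [in X in _ + X]mxE [RHS]mxE.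
  rewrite !tensmxE !mxE (can_eq (@mxtens_indexK 2 h)) xpair_eqE.
  by case: i => [[|[|i]] //= hi]; case: j => [[|[|j]] //= hj];
    rewrite -?val_eqE /= ?mul1r ?mul0r ?addr0 ?add0r ?subr0 ?oppr0.
rewrite mulmxDr mulmxDl mxE addr_ge0 //.
- by apply: psdmx_qproj; exact: leA.
- by apply: psdmx_qproj; exact: leB.
Qed.

Lemma loewner_le01 : loewner_le (0 : 'M[C]_h) 1%:M.
Proof.
move=> x; rewrite subr0 mulmx1 mxE sumr_ge0 // => i _.
by rewrite !mxE mulrC mul_conjC_ge0.
Qed.

Lemma qalt0r_op E : qproj C 0 *t E = qalt_op E 0.
Proof. by rewrite /qalt_op tensmx0 addr0. Qed.

Lemma qalt0l_op F : qproj C 1 *t F = qalt_op 0 F.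
Proof. by rewrite /qalt_op tensmx0 add0r. Qed.

Lemma qalt_neq0 S T : 0 \notin qalt_ops S T.
Proof.
have nz (U : kraus C h k) E : E \in kraus_ops U -> E <> 0.
  by move=> UE e0; move: (kraus_neq0 U); rewrite -e0 UE.
apply/negP; rewrite /qalt_ops; case: ifPn => [_|T0]; [|case: ifPn => [_|S0]].
- case/imfsetP => E /= SE /esym; rewrite qalt0r_op => /qalt_op_eq0 [e _].
  exact: nz SE e.
- case/imfsetP => F /= TF /esym; rewrite qalt0l_op => /qalt_op_eq0 [_ e].
  exact: nz TF e.
- case/imfset2P => E /= SE [F /= TF] /esym /qalt_op_eq0 [/eqP e _].
  move: e; rewrite scaler_eq0 invr_eq0 sqrtC_eq0 pnatr_eq0 cardfs_eq0 (negPf T0).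
  by move=> /eqP /(nz _ _ SE).
Qed.

Lemma gramZ (m n c : nat) (E : 'M[C]_(m, n)) :
  ((sqrtC c%:R)^-1 *: E) ^t* *m ((sqrtC c%:R)^-1 *: E) = c%:R^-1 *: (E ^t* *m E).
Proof.
have -> : ((sqrtC c%:R)^-1 *: E) ^t* = (sqrtC c%:R)^-1 *: E ^t*.
  apply/matrixP => i j; rewrite !mxE rmorphM /=; congr (_ * _).
  by rewrite conj_Creal // rpredV ger0_real // sqrtC_ge0 ler0n.
by rewrite -scalemxAl -scalemxAr scalerA -invfM -expr2 sqrtCK.
Qed.

Lemma qalt_gram S T :
  \sum_(G <- qalt_ops S T) G ^t* *m G
  = qproj C 0 *t (\sum_(E <- kraus_ops S) E ^t* *m E)
    + qproj C 1 *t (\sum_(F <- kraus_ops T) F ^t* *m F).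
Proof.
rewrite /qalt_ops; case: ifPn => [/eqP ->|T0]; [|case: ifPn => [/eqP ->|S0]].
- rewrite big_seq_fset0 tensmx0 addr0 tensmx_sumr big_imfset /=; last first.
    by move=> E E' _ _; rewrite !qalt0r_op => /qalt_op_inj [].
  apply: eq_bigr => E _.
  by rewrite qalt0r_op qalt_op_gram mulmx0 tensmx0 addr0.
- rewrite big_seq_fset0 tensmx0 add0r tensmx_sumr big_imfset /=; last first.
    by move=> E E' _ _; rewrite !qalt0l_op => /qalt_op_inj [].
  apply: eq_bigr => E _.
  by rewrite qalt0l_op qalt_op_gram mulmx0 tensmx0 add0r.
have nzr (A : {fset 'M[C]_(k, h)}) : A != fset0 -> #|` A|%:R != 0 :> C.
  by rewrite pnatr_eq0 cardfs_eq0.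
have sc0 (A : {fset 'M[C]_(k, h)}) : A != fset0 -> (sqrtC #|` A|%:R)^-1 != 0 :> C.
  by move=> /nzr; rewrite invr_eq0 sqrtC_eq0.
rewrite big_imfset2 /=; last first.
  move=> [E F] [E' F'] _ _ /= /qalt_op_inj [].
  by move=> /(scalerI (sc0 _ T0)) -> /(scalerI (sc0 _ S0)) ->.
have sum_const (A : {fset 'M[C]_(k, h)}) (M : 'M[C]_h) : A != fset0 ->
    \sum_(E <- A) #|` A|%:R^-1 *: M = M.
  move=> A0; rewrite big_const_seq count_predT iter_addr_0 -scaler_nat scalerA.
  by rewrite mulfV ?scale1r ?nzr.
pose GT := \sum_(F <- kraus_ops T) F ^t* *m F.
transitivity (\sum_(E <- kraus_ops S)
    (qproj C 0 *t (E ^t* *m E) + qproj C 1 *t (#|` kraus_ops S|%:R^-1 *: GT))).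
  apply: eq_bigr => E _.
  under eq_bigr => F _ do rewrite qalt_op_gram !gramZ.
  by rewrite big_split /= -!tensmx_sumr sum_const // -scaler_sumr.
by rewrite big_split /= -!tensmx_sumr sum_const.
Qed.

Lemma qalt_kraus_le1 S T :
  loewner_le (\sum_(G <- qalt_ops S T) G ^t* *m G) 1%:M.
Proof. by rewrite qalt_gram; apply: qalt_le1; exact: kraus_le1. Qed.

End QaltKraus.

Definition qalt (C : numClosedFieldType) (h k : nat) (S T : kraus C h k) :
    kraus C (2 * h) (2 * k) :=
  Kraus (qalt_neq0 S T) (qalt_kraus_le1 S T).

(* Main.v *)
Require Import Defs.
From HB Require Import structures.
From mathcomp Require Import all_boot all_order all_algebra.
From mathcomp Require Import complex reals.
From mathcomp Require Import finmap mxtens.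
Import Order.TTheory GRing.Theory Num.Theory.
Local Open Scope ring_scope.
Local Open Scope sesquilinear_scope.

(** On [H = K = C], take [S] empty and [S' = T = T' = {1}].  Then [S . T] is
    [{Pi_1}] while [S' . T'] is [{Pi_0 + Pi_1} = {1}].  The map
    [rho |-> rho - Pi_1 rho Pi_1] is not even positive: with [u = (1, 1)] and
    [x = (1, -1)] one has [<x, u> = 0] but [<x, Pi_1 u> <> 0], so [|u><u|] is
    sent to an operator with a negative expectation at [x]. *)

Section KrausOrder.
Context {C : numClosedFieldType}.

Lemma adjmxE (m n : nat) (A : 'M[C]_(m, n)) i j : (A ^t*) i j = (A j i)^*.
Proof. by rewrite !mxE. Qed.

(* The product [1 * 1] is only convertible to [1]; stating the left-hand side
   at dimension [1] hides the type mismatch from later uses. *)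
Lemma sesqui_tens (m n p q : nat) (A : 'M[C]_(m, n)) (B : 'M[C]_(p, q))
    (x : 'cV[C]_m) (y : 'cV[C]_p) (u : 'cV[C]_n) (v : 'cV[C]_q) :
  (((x *t y : 'cV[C]_(m * p)) ^t* *m (A *t B) *m (u *t v)) : 'M[C]_1) 0 0
  = (x ^t* *m A *m u) 0 0 * (y ^t* *m B *m v) 0 0.
Proof.
transitivity (((x *t y) ^t* *m (A *t B) *m (u *t v))
    (mxtens_index (0, 0)) (mxtens_index (0, 0))).
  by congr (fun_of_matrix _ _ _); apply/val_inj.
by rewrite adjmx_tens !tensmx_mul tensmxE.
Qed.

(** Complete positivity is tested on [qproj C 0 *t A]: its ampliation is [qproj C 0 *t f A], whose
    form at [delta_mx 0 0 *t y] is that of [f A] at [y]. *)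
Lemma cp_positive {h k : nat} {f : {linear 'M[C]_h -> 'M[C]_k}} {A : 'M[C]_h} :
  completely_positive f -> psdmx A -> psdmx (f A).
Proof.
move=> cpf psdA y.
have := cpf 2 _ (psdmx_qproj 0 psdA) ((delta_mx 0 0 : 'cV_2) *t y).
rewrite ampliation_tens sesqui_tens.
have -> : (delta_mx 0 0 : 'cV[C]_2) ^t* *m qproj C 0 *m delta_mx 0 0 = 1%:M.
  rewrite /qproj -mulmxA mul_delta_mx trmx_delta map_delta_mx mul_delta_mx.
  by apply/matrixP => i j; rewrite !ord1 !mxE.
by rewrite mxE mul1r.
Qed.

Lemma psdmx_rank1 {n : nat} (u : 'cV[C]_n) : psdmx (u *m u ^t*).
Proof.
move=> x; rewrite mulmxA -mulmxA.
have -> : u ^t* *m x = (x ^t* *m u) ^t* by rewrite trmx_mul map_mxM trmxCK.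
by rewrite mxE big_ord1 adjmxE mul_conjC_ge0.
Qed.

(** Each Kraus operator sends the rank-one operator of [u] to that of [E *m u]. *)
Lemma superop_rank1 (h k : nat) (S : {fset 'M[C]_(k, h)}) (u : 'cV[C]_h)
    (x : 'cV[C]_k) :
  (x ^t* *m superop S (u *m u ^t*) *m x) 0 0
  = \sum_(E <- S) `|(x ^t* *m E *m u) 0 0| ^+ 2.
Proof.
rewrite /superop mulmx_sumr mulmx_suml summxE; apply: eq_bigr => E _.
have -> : x ^t* *m (E *m (u *m u ^t*) *m E ^t*) *m x
    = (x ^t* *m E *m u) *m (x ^t* *m E *m u) ^t*.
  by rewrite !trmx_mul !map_mxM trmxCK !mulmxA.
by rewrite mxE big_ord1 adjmxE normCK.
Qed.

(** Evaluated on [u *m u ^t*] and tested at [x], the difference of the superoperators is minus a sum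
    of squared moduli over [S], since the [T] part vanishes. Positivity then forces every square to
    be zero. *)
Lemma cp_le_kernel {h k : nat} {S T : {fset 'M[C]_(k, h)}}
    {u : 'cV[C]_h} {x : 'cV[C]_k} :
    cp_le (superop S) (superop T) ->
    (forall F, F \in T -> (x ^t* *m F *m u) 0 0 = 0) ->
  forall E, E \in S -> (x ^t* *m E *m u) 0 0 = 0.
Proof.
move=> leST T0 E SE.
have := cp_positive leST (psdmx_rank1 u) x.
rewrite /= mulmxBr mulmxBl mxE [X in _ + X]mxE !superop_rank1.
rewrite [X in X - _]big_seq big1 => [|F TF]; last by rewrite T0 // normr0 expr0n.
rewrite sub0r oppr_ge0 (big_fsetD1 E) //= => le0.
apply/eqP; rewrite -normr_eq0 -sqrf_eq0 eq_le exprn_ge0 // andbT.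
by apply: le_trans le0; rewrite lerDl sumr_ge0 // => F _; rewrite exprn_ge0.
Qed.

Lemma kraus_le_refl (h k : nat) (S : kraus C h k) : kraus_le S S.
Proof.
move=> d X _ x; rewrite /ampliation big1 ?mulmx0 ?mul0mx ?mxE // => i _.
by rewrite big1 // => j _; rewrite /= subrr tensmx0.
Qed.

Lemma ampliation_id (d h : nat) (X : 'M[C]_(d * h)) : ampliation id X = X.
Proof.
apply/matrixP => r s.
case: (mxtens_indexP r) => i a; case: (mxtens_indexP s) => j b.
rewrite /ampliation summxE (bigD1 i) //= summxE (bigD1 j) //= !big1 ?addr0.
- by rewrite tensmxE !mxE !eqxx mul1r.
- move=> i' hi; rewrite summxE big1 // => j' _.
  by rewrite tensmxE mxE [i == i']eq_sym (negPf hi) mul0r.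
- by move=> j' hj; rewrite tensmxE mxE [j == j']eq_sym (negPf hj) andbF mul0r.
Qed.

Lemma kraus_empty_le1 (h k : nat) :
  loewner_le (\sum_(E <- (fset0 : {fset 'M[C]_(k, h)})) E ^t* *m E) 1%:M.
Proof. by rewrite big_seq_fset0; exact: loewner_le01. Qed.

Definition kraus_empty (h k : nat) : kraus C h k :=
  Kraus (negbT (in_fset0 0)) (kraus_empty_le1 h k).

(** In dimension [n.+1] the identity is nonzero, as a Kraus operator must be. *)
Lemma kraus_id_neq0 (n : nat) : 0 \notin [fset (1%:M : 'M[C]_n.+1)]%fset.
Proof. by rewrite in_fset1 eq_sym oner_eq0. Qed.

Lemma kraus_id_le1 (n : nat) :
  loewner_le (\sum_(E <- [fset (1%:M : 'M[C]_n.+1)]%fset) E ^t* *m E) 1%:M.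
Proof.
rewrite big_seq_fset1 trmx1 map_mx1 mulmx1 => x.
by rewrite subrr mulmx0 mul0mx mxE.
Qed.

Definition kraus_id (n : nat) : kraus C n.+1 n.+1 :=
  Kraus (kraus_id_neq0 n) (kraus_id_le1 n).

(** The difference of the superoperators is the identity map, whose ampliation fixes [X]. *)
Lemma kraus_empty_le_id (n : nat) : kraus_le (kraus_empty n.+1 n.+1) (kraus_id n).
Proof.
move=> d X psdX.
suff -> : ampliation (superop (kraus_id n) \- superop (kraus_empty n.+1 n.+1)) X
    = ampliation id X by rewrite ampliation_id.
rewrite /ampliation; apply: eq_bigr => i _; apply: eq_bigr => j _.
rewrite /= /superop big_seq_fset1 big_seq_fset0 subr0.
by rewrite trmx1 map_mx1 mulmx1 mul1mx.
Qed.

Lemma qalt_empty_id_mem (n : nat) :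
  qproj C 1 *t 1%:M \in kraus_ops (qalt (kraus_empty n.+1 n.+1) (kraus_id n)).
Proof.
rewrite /= /qalt_ops /= ifN; first by rewrite in_imfset //= in_fset1.
by apply/fset0Pn; exists 1%:M; rewrite in_fset1.
Qed.

Lemma qalt_id_id_mem (n : nat) F :
  F \in kraus_ops (qalt (kraus_id n) (kraus_id n)) -> F = qalt_op 1%:M 1%:M.
Proof.
have n0 : ([fset (1%:M : 'M[C]_n.+1)] != fset0)%fset.
  by apply/fset0Pn; exists 1%:M; rewrite in_fset1.
rewrite /= /qalt_ops /= !ifN // cardfs1 sqrtC1 invr1.
by case/imfset2P => E /= /fset1P -> [G /= /fset1P ->]; rewrite !scale1r.
Qed.

Lemma qalt_not_monotone_left :
  ~ kraus_le (qalt (kraus_empty 1 1) (kraus_id 0)) (qalt (kraus_id 0) (kraus_id 0)).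
Proof.
pose u : 'cV[C]_2 := const_mx 1.
pose x : 'cV[C]_2 := \col_i (-1) ^+ i.
pose e : 'cV[C]_1 := 1%:M.
(* The signs of [x] make the two branches contribute 1 and -1: they cancel in [qalt_op 1%:M 1%:M],
   while the branch [b = 1] alone gives -1. *)
have form (b : 'I_2) :
    ((x *t e : 'cV_(2 * 1)) ^t* *m (qproj C b *t 1%:M) *m (u *t e)) 0 0
    = (-1) ^+ b.
  rewrite sesqui_tens /e trmx1 map_mx1 !mulmx1 [X in _ * X]mxE.
  rewrite eqxx mulr1 /qproj -mulmxA mxE (bigD1 b) //= big1 => [|i ib].
    rewrite addr0 adjmxE !mxE (bigD1 b) //= big1 => [|i ib].
      by rewrite !mxE !eqxx mulr1 addr0 mulr1 rmorphXn rmorphN1.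
    by rewrite !mxE (negPf ib) andbF mul0r.
  by rewrite !mxE big1 ?mulr0 // => j _; rewrite !mxE (negPf ib) mul0r.
move=> le.
have T0 F : F \in kraus_ops (qalt (kraus_id 0) (kraus_id 0)) ->
    ((x *t e : 'cV_(2 * 1)) ^t* *m F *m (u *t e)) 0 0 = 0.
  move=> /qalt_id_id_mem ->; rewrite /qalt_op mulmxDr mulmxDl mxE.
  by rewrite !form expr0 expr1 subrr.
have := cp_le_kernel le T0 _ (qalt_empty_id_mem 0).
by rewrite form expr1 => /eqP; rewrite oppr_eq0 oner_eq0.
Qed.

End KrausOrder.

Theorem mainTheorem1 (R : realType) :
  exists (h k : nat) (S S' T T' : kraus R[i] h k),
    [/\ kraus_le S S', kraus_le T T' & ~ kraus_le (qalt S T) (qalt S' T')].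
Proof.
(* [kraus_id 0] lives in dimension 1. Only the left argument grows, from empty to the identity. *)
exists 1, 1, (kraus_empty 1 1), (kraus_id 0), (kraus_id 0), (kraus_id 0); split.
- exact: kraus_empty_le_id.
- exact: kraus_le_refl.
- exact: qalt_not_monotone_left.
Qed.
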